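(* Let $\mathcal{D}$ be a weighted oriented graph on the vertices $V(\mathcal{D})=\{x_1,\ldots,x_n\}$ with weights $w_i=w(x_i)$, and let $R=k[x_1,\ldots,x_n]$. Then $$\operatorname{pdim}(R/I(\mathcal{D}))=n$$ if and only if for each $x_i\in V(\mathcal{D})$ there is an edge $e=(x_j,x_i)\in E(\mathcal{D})$ oriented towards $x_i$ such that $x_j$ has a non-trivial weight. Furthermore, $$\operatorname{pdim}(R/I(\mathcal{D}))=n \quad\text{if and only if}\quad \beta_{n,\mathbf{b}}(R/I(\mathcal{D}))\neq 0,$$ where $\mathbf{b}=(w_1,\ldots,w_n)\in\mathbb{N}^n$.
   Context: An oriented graph $\mathcal{D}=(V(\mathcal{D}),E(\mathcal{D}))$ is a finite simple graph (no loops, no multiple edges) in which each edge is given exactly one orientation; $(x,y)\in E(\mathcal{D})$ denotes an edge oriented from $x$ to $y$. It is weighted if it comes with a function $w:V(\mathcal{D})\to\mathbb{N}^+$; write $w_i=w(x_i)$. A vertex $x_i$ has trivial weight if $w_i=1$ and non-trivial weight if $w_i>1$. A source vertex is a vertex having only outgoing edges; the weights of source vertices do not affect the edge ideal, and by convention $w_i=1$ if $x_i$ is a source vertex. With $k$ a field and $R=k[x_1,\ldots,x_n]$, the edge ideal of $\mathcal{D}$ is $I(\mathcal{D})=(x_ix_j^{w_j} : (x_i,x_j)\in E(\mathcal{D}))\subseteq R$. For a monomial ideal $I$, $\beta_{i,\mathbf{b}}(R/I)$ denotes the $i$-th $\mathbb{N}^n$-graded Betti number in multidegree $\mathbf{b}$,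 and $\operatorname{pdim}$ denotes projective dimension over $R$. *)

(* Defs.v *)
From HB Require Import structures.
From mathcomp Require Import all_boot all_order all_algebra.
From mathcomp Require Import generic_quotient ring_quotient mpoly boolp.

Set Implicit Arguments.
Unset Strict Implicit.
Unset Printing Implicit Defensive.

Import GRing.Theory.
Local Open Scope ring_scope.
Local Open Scope quotient_scope.

(* The ideal (g_0, ..., g_(m-1)), as a predicate that is boolean by classical
   logic so that MathComp's quotient construction applies to it. *)
Definition ideal_gen (R : comNzRingType) (s : seq R) : {pred R} :=
  fun f => `[< exists c : 'I_(size s) -> R, f = \sum_i c i * s`_i >].

Section QuotientModule.
Variables (R : comNzRingType) (s : seq R).

Lemma ideal_genP (f : R) :
  reflect (exists c : 'I_(size s) -> R, f = \sum_i c i * s`_i)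
          (f \in ideal_gen s).
Proof. exact: asboolP. Qed.

Fact ideal_gen_zmod_closed : zmod_closed (ideal_gen s).
Proof.
split.
  apply/ideal_genP; exists (fun=> 0).
  by rewrite big1 // => i _; rewrite mul0r.
move=> x y /ideal_genP[c ->] /ideal_genP[d ->]; apply/ideal_genP.
exists (fun i => c i - d i); rewrite -sumrB.
by apply: eq_bigr => i _; rewrite mulrBl.
Qed.

HB.instance Definition _ :=
  GRing.isZmodClosed.Build R (ideal_gen s) ideal_gen_zmod_closed.

Lemma ideal_gen_mull (a x : R) : x \in ideal_gen s -> a * x \in ideal_gen s.
Proof.
move=> /ideal_genP[c ->]; apply/ideal_genP; exists (fun i => a * c i).
by rewrite mulr_sumr; apply: eq_bigr => i _; rewrite mulrA.
Qed.

(* The R-module R / (s). The library only gives quotients by a *proper* ideal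
   a ring structure and never an R-module structure. *)
Definition quot_ideal : Type := Quotient.quot (ideal_gen s).

HB.instance Definition _ := GRing.Zmodule.on quot_ideal.

Definition quot_class (x : R) : quot_ideal :=
  \pi_(Quotient.quot (ideal_gen s)) x.

Lemma quot_class_eq (x y : R) :
  (quot_class x == quot_class y) = (x - y \in ideal_gen s).
Proof. by rewrite Quotient.idealrBE. Qed.

Lemma quot_classP (y : quot_ideal) : {x : R | y = quot_class x}.
Proof.
by exists (repr (y : Quotient.quot (ideal_gen s))); rewrite /quot_class reprK.
Qed.

Lemma quot_classD (x y : R) : quot_class (x + y) = quot_class x + quot_class y.
Proof. exact: Quotient.pi_add. Qed.

Definition quot_scale (a : R) (y : quot_ideal) : quot_ideal :=
  quot_class (a * repr (y : Quotient.quot (ideal_gen s))).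

Lemma quot_scale_class (a x : R) :
  quot_scale a (quot_class x) = quot_class (a * x).
Proof.
apply/eqP; rewrite quot_class_eq -mulrBr; apply: ideal_gen_mull.
by rewrite -quot_class_eq /quot_class reprK.
Qed.

Fact quot_scaleA a b x : quot_scale a (quot_scale b x) = quot_scale (a * b) x.
Proof. by have [y ->] := quot_classP x; rewrite 3!quot_scale_class mulrA. Qed.

Fact quot_scale1 : left_id 1 quot_scale.
Proof.
by move=> x; have [y ->] := quot_classP x; rewrite quot_scale_class mul1r.
Qed.

Fact quot_scaleDr : right_distributive quot_scale +%R.
Proof.
move=> a x y; have [[u ->] [v ->]] := (quot_classP x, quot_classP y).
by rewrite -quot_classD 3!quot_scale_class mulrDr quot_classD.
Qed.

Fact quot_scaleDl x : {morph quot_scale^~ x : a b / a + b}.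
Proof.
move=> a b; have [u ->] := quot_classP x.
by rewrite 3!quot_scale_class mulrDl quot_classD.
Qed.

HB.instance Definition _ :=
  GRing.Zmodule_isLmodule.Build R quot_ideal
    quot_scaleA quot_scale1 quot_scaleDr quot_scaleDl.

End QuotientModule.

Section ProjectiveDimension.
Variable R : nzRingType.

Definition projective (P : lmodType R) : Prop :=
  forall (M N : lmodType R) (g : {linear M -> N}) (f : {linear P -> N}),
    (forall y, exists x, g x = y) ->
    exists h : {linear P -> M}, forall x, g (h x) = f x.

Record projective_resolution (M : lmodType R) := ProjectiveResolution {
  pres_mod : nat -> lmodType R;
  pres_diff : forall i, {linear pres_mod i.+1 -> pres_mod i};
  pres_aug : {linear pres_mod 0%N -> M};
  pres_projective : forall i, projective (pres_mod i);
  pres_aug_surj : forall y, exists x, pres_aug x = y;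
  pres_exact0 : forall x, pres_aug x = 0 <-> exists y, pres_diff 0%N y = x;
  pres_exactS : forall i x,
    pres_diff i x = 0 <-> exists y, pres_diff i.+1 y = x
}.

Definition pdim_le (M : lmodType R) (d : nat) : Prop :=
  exists F : projective_resolution M,
    forall i, (d < i)%N -> forall x : pres_mod F i, x = 0.

Definition pdim_eq (M : lmodType R) (d : nat) : Prop :=
  pdim_le M d /\ forall e, pdim_le M e -> (d <= e)%N.

End ProjectiveDimension.

Section MultigradedBetti.
Variables (k : fieldType) (n : nat).
Local Notation R := {mpoly k[n]}.

(* A minimal N^n-graded free resolution of R/(s) by modules of finite rank.
   F_i is the direct sum of the R(- mfr_deg i p), p < mfr_rank i; its elements
   are row vectors, and the differential F_(i+1) -> F_i is u |-> u *m mfr_diff i.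
   The augmentation F_0 -> R/(s) is the class of u |-> u *m mfr_aug. A matrix
   defines a degree-preserving map iff every monomial of its (p, q) entry has
   degree (degree of source generator p) - (degree of target generator q).
   Minimality says that the differentials map F_(i+1) into (x_1..x_n) F_i. *)
Record minimal_free_resolution (s : seq R) := MinimalFreeResolution {
  mfr_rank : nat -> nat;
  mfr_deg : forall i, 'I_(mfr_rank i) -> 'X_{1..n};
  mfr_diff : forall i, 'M[R]_(mfr_rank i.+1, mfr_rank i);
  mfr_aug : 'cV[R]_(mfr_rank 0);
  mfr_aug_homog : forall p m, m \in msupp (mfr_aug p ord0) -> m = mfr_deg p;
  mfr_diff_homog : forall i p q m, m \in msupp (mfr_diff i p q) ->
    (m + mfr_deg q)%MM = mfr_deg p;
  mfr_aug_surj : forall f : R, exists u : 'rV[R]_(mfr_rank 0),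
    (u *m mfr_aug) ord0 ord0 - f \in ideal_gen s;
  mfr_exact0 : forall u : 'rV[R]_(mfr_rank 0),
    (u *m mfr_aug) ord0 ord0 \in ideal_gen s <->
    exists v, u = v *m mfr_diff 0;
  mfr_exactS : forall i (u : 'rV[R]_(mfr_rank i.+1)),
    u *m mfr_diff i = 0 <-> exists v, u = v *m mfr_diff i.+1;
  mfr_minimal : forall i p q, (mfr_diff i p q)@_0%MM = 0
}.

Definition mfr_betti (s : seq R) (F : minimal_free_resolution s)
    (i : nat) (b : 'X_{1..n}) : nat :=
  #|[set p : 'I_(mfr_rank F i) | mfr_deg p == b]|.

(* beta_(i,b)(R/(s)), the number of generators of multidegree b in step i of
   a minimal free resolution. For a monomial ideal such a resolution exists and
   is unique up to isomorphism, so the choice is immaterial; 0 is a dummy value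
   for ideals without one. *)
Definition betti (s : seq R) (i : nat) (b : 'X_{1..n}) : nat :=
  if pselect (exists F : minimal_free_resolution s, True) is left h
  then mfr_betti (projT1 (cid h)) i b else 0%N.

End MultigradedBetti.

(* oedge x y is an edge oriented from x to y; a source is a vertex into which no
   edge is oriented. *)
Record wograph (n : nat) := WOGraph {
  oedge : rel 'I_n;
  weight : 'I_n -> nat;
  oedge_irrefl : irreflexive oedge;
  oedge_asym : forall x y, oedge x y -> ~~ oedge y x;
  weight_gt0 : forall x, (0 < weight x)%N;
  weight_source : forall x, (forall y, ~~ oedge y x) -> weight x = 1%N
}.

Definition edge_ideal_gens (k : fieldType) (n : nat) (D : wograph n) :
    seq {mpoly k[n]} :=
  [seq 'X_e.1 * 'X_e.2 ^+ weight D e.2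
     | e <- enum [pred e : 'I_n * 'I_n | oedge D e.1 e.2]].

(* Main.v *)
(* The Koszul complex identifies Tor_n(R/I, k) with the socle (I : m)/I of
   R/I, shifted by (1, ..., 1), so pdim R/I = n exactly when some monomial
   x^a outside I satisfies x_i x^a in I for all i. For an edge ideal the
   edge dividing x_i x^a must point towards x_i, since an edge (x_i, x_j)
   would give a_j >= w_j and leave no edge to divide x_j x^a. Hence a = w -
   (1, ..., 1), the source of each of these edges has positive exponent,
   i.e. non-trivial weight, and the n-th syzygies live in degree w only.

   The identification is made by dimension shifting along an arbitrary exact
   complex on whose terms x_1, ..., x_n is regular, which covers projective
   resolutions as well as minimal free ones. Minimal free resolutions of
   monomial ideals exist because every syzygy module of a graded module that
   is determined in degrees below a bound B is again determined in degrees
   below B, so that finitely many vector spaces over k carry all the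
   information. *)

From HB Require Import structures.
Require Import Defs.
From mathcomp Require Import all_boot all_order all_algebra.
From mathcomp Require Import freeg mpoly boolp.

Set Implicit Arguments.
Unset Strict Implicit.
Unset Printing Implicit Defensive.

Import GRing.Theory.
Local Open Scope ring_scope.

(** * Koszul homology by dimension shifting *)

Section RegularSequences.
Variables (R : comNzRingType) (x : nat -> R).

Definition in_multiples (V : lmodType R) (j : nat) (u : V) : Prop :=
  exists g : nat -> V, u = \sum_(l < j) x l *: g l.

(** Multiplication by [x j] is injective on V/(x_0, ..., x_(j-1))V, phrased through relations to
    avoid quotient modules. V/(x)V may be zero, hence only weakly. *)
Definition weakly_regular (V : lmodType R) (N : nat) : Prop :=
  forall j (g : nat -> V), (j < N)%N ->
    \sum_(l < j.+1) x l *: g l = 0 -> in_multiples j (g j).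

Lemma in_multiples0 (V : lmodType R) j : in_multiples j (0 : V).
Proof. by exists (fun=> 0); rewrite big1 // => l _; rewrite scaler0. Qed.

Lemma in_multiples1 (V : lmodType R) j l (v : V) :
  (l < j)%N -> in_multiples j (x l *: v).
Proof.
move=> ltlj; exists (fun i => if i == l then v else 0).
rewrite (bigD1 (Ordinal ltlj)) //= eqxx big1 ?addr0 // => i ne_il.
by rewrite ifN ?scaler0.
Qed.

Lemma in_multiplesD (V : lmodType R) j (u v : V) :
  in_multiples j u -> in_multiples j v -> in_multiples j (u + v).
Proof.
move=> [f ->] [g ->]; exists (fun l => f l + g l); rewrite -big_split /=.
by apply: eq_bigr => l _; rewrite scalerDr.
Qed.

Lemma in_multiples_sum (V : lmodType R) j (I : eqType) (s : seq I) (F : I -> V) :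
  {in s, forall i, in_multiples j (F i)} -> in_multiples j (\sum_(i <- s) F i).
Proof.
move=> sF; rewrite big_seq; apply: big_ind => //; first exact: in_multiples0.
exact: in_multiplesD.
Qed.

Lemma in_multiples_scaler (V : lmodType R) j (a : R^o) (v : V) :
  in_multiples j a -> in_multiples j (a *: v).
Proof.
move=> [g ->]; exists (fun l => g l *: v); rewrite scaler_suml.
by apply: eq_bigr => l _; rewrite scalerA.
Qed.

Section Complex.
Variables (F : nat -> lmodType R) (d : forall i, {linear F i.+1 -> F i}).
Variable N : nat.
Hypothesis exact_d : forall i u, d i u = 0 <-> exists v, d i.+1 v = u.
Hypothesis reg_F : forall i, weakly_regular (F i) N.

Lemma diff_comp i v : d i (d i.+1 v) = 0.
Proof. by apply/exact_d; exists v. Qed.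

(** The Koszul complex on j elements has length j, so its homology in degree i+1 > j with
    coefficients in coker d_0 vanishes. *)
Lemma image_in_multiples j i y : (j <= i)%N -> (j <= N)%N ->
  in_multiples j (d i y) ->
  exists z : nat -> F i.+1, d i y = \sum_(l < j) x l *: d i (z l).
Proof.
elim: j i y => [|j IHj] i y leji lejN [f def_dy].
  by exists (fun=> 0); rewrite def_dy !big_ord0.
case: i => // i in leji y f def_dy *.
have [|h def_h] := @reg_F i j (fun l => d i (f l)) lejN.
  rewrite -[RHS](diff_comp y) def_dy linear_sum.
  by apply: eq_bigr => l _; rewrite linearZ.
have [z def_z] := IHj i (f j) leji (ltnW lejN) (ex_intro _ h def_h).
have /exact_d[t def_t] : d i (f j - \sum_(l < j) x l *: z l) = 0.
  rewrite linearB linear_sum [X in X - _]def_z -sumrB big1 // => l _.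
  by rewrite linearZ subrr.
(* Subtracting x_j t trades the coefficient of x_j for multiples of x_0, ..., x_(j-1), so the
   induction hypothesis applies. *)
have [|z' def_z'] := IHj i.+1 (y - x j *: t) (ltnW leji) (ltnW lejN).
  exists (fun l => f l + x j *: z l).
  rewrite linearB linearZ def_t def_dy big_ord_recr /= scalerBr.
  rewrite opprB addrACA subrr addr0 scaler_sumr -big_split /=.
  by apply: eq_bigr => l _; rewrite scalerDr !scalerA mulrC.
exists (fun l => if l == j then t else z' l).
rewrite big_ord_recr /= eqxx -[y in LHS](subrK (x j *: t)) linearD /=.
by rewrite def_z' linearZ; congr (_ + _); apply: eq_bigr => l _; rewrite ltn_eqF.
Qed.

(* Koszul j u f means that the class of u in
   Tor_(j+1)(coker d_0, R/(x_0, ..., x_j)), computed from the resolution F as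
   (im d_j \cap (x_0, ..., x_j) F_j) / (x_0, ..., x_j) im d_j, corresponds to
   the class of f in the submodule (0 : (x_0, ..., x_j)) of coker d_0. *)
Fixpoint Koszul j : F j -> F 0%N -> Prop :=
  if j is j'.+1 then fun u f =>
    exists2 g : nat -> F j'.+1,
      u = \sum_(l < j'.+2) x l *: g l & Koszul (d j' (g j'.+1)) f
  else fun u f => u = x 0%N *: f.

Lemma KoszulZ a j u f : @Koszul j u f -> Koszul (a *: u) (a *: f).
Proof.
elim: j u f => [|j IHj] u f /=; first by move->; rewrite !scalerA mulrC.
case=> g -> Kg; exists (fun l => a *: g l); last by rewrite linearZ; apply: IHj.
by rewrite scaler_sumr; apply: eq_bigr => l _; rewrite !scalerA mulrC.
Qed.

(** Every class has a partner: applying the differential to a relation for d_j y and using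
    regularity, the boundary of the last coefficient again lies in the multiples of the earlier
    elements. *)
Lemma Koszul_exists j y : (j < N)%N -> in_multiples j.+1 (d j y) ->
  exists f, Koszul (d j y) f.
Proof.
elim: j y => [|j IHj] y ltjN [g def_dy].
  by exists (g 0%N); rewrite /= def_dy big_ord1.
have [|h def_h] := @reg_F j j.+1 (fun l => d j (g l)) ltjN.
  rewrite -[RHS](diff_comp y) def_dy linear_sum.
  by apply: eq_bigr => l _; rewrite linearZ.
by have [f Kf] := IHj (g j.+1) (ltnW ltjN) (ex_intro _ h def_h); exists f, g.
Qed.

(** Injectivity on classes: a partner that vanishes in coker d_0 forces a trivial Tor class. *)
Lemma Koszul_inj j y t : (j < N)%N -> Koszul (d j y) (d 0%N t) ->
  exists z : nat -> F j.+1, d j y = \sum_(l < j.+1) x l *: d j (z l).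
Proof.
elim: j y => [|j IHj] y ltjN /=; first by move->; exists (fun=> t); rewrite big_ord1.
case=> g def_dy /(IHj _ (ltnW ltjN))[z def_z].
have /exact_d[s def_s] : d j (g j.+1 - \sum_(l < j.+1) x l *: z l) = 0.
  rewrite linearB linear_sum def_z -sumrB big1 // => l _.
  by rewrite linearZ subrr.
have [|z' def_z'] :=
    @image_in_multiples j.+1 j.+1 (y - x j.+1 *: s) (leqnn _) (ltnW ltjN).
  exists (fun l => g l + x j.+1 *: z l).
  rewrite linearB linearZ def_s def_dy big_ord_recr /= scalerBr.
  rewrite opprB addrACA subrr addr0 scaler_sumr -big_split /=.
  by apply: eq_bigr => l _; rewrite scalerDr !scalerA mulrC.
exists (fun l => if l == j.+1 then s else z' l).
rewrite big_ord_recr /= eqxx -[y in LHS](subrK (x j.+1 *: s)) linearD /=.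
by rewrite def_z' linearZ; congr (_ + _); apply: eq_bigr => l _; rewrite ltn_eqF.
Qed.

(** Well-definedness on classes, converse to [Koszul_inj]. By regularity the last coefficients of
    the two expansions differ by multiples of the earlier elements, which reproduces the hypothesis
    one degree lower. *)
Lemma Koszul_boundary j f (z : nat -> F j.+1) : (j < N)%N ->
  Koszul (\sum_(l < j.+1) x l *: d j (z l)) f -> exists t, d 0%N t = f.
Proof.
elim: j f z => [|j IHj] f z ltjN /=.
  rewrite big_ord1 => /eqP; rewrite -subr_eq0 -scalerBr => /eqP eq0.
  have [|h] := @reg_F 0 0%N (fun=> d 0%N (z 0%N) - f) ltjN; first by rewrite big_ord1.
  by rewrite big_ord0 => /eqP; rewrite subr_eq0 => /eqP <-; exists (z 0%N).
case=> g eq_g Kg.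
have [|h def_h] := @reg_F j.+1 j.+1 (fun l => g l - d j.+1 (z l)) ltjN.
  by under eq_bigr do rewrite scalerBr; rewrite sumrB -eq_g subrr.
apply: (IHj f h); first exact: ltnW.
suff <- : d j (g j.+1) = \sum_(l < j.+1) x l *: d j (h l) by [].
have /(congr1 (d j)) := def_h; rewrite linearB diff_comp subr0 => ->.
by rewrite linear_sum; apply: eq_bigr => l _; rewrite linearZ.
Qed.

Lemma Koszul_surj j f : (j < N)%N ->
  (forall l, (l <= j)%N -> exists t, d 0%N t = x l *: f) ->
  exists y, Koszul (d j y) f.
Proof.
elim: j => [|j IHj] ltjN ann_f; first exact: ann_f.
have [l /leqW/ann_f//|y Kyf] := IHj (ltnW ltjN).
have [t def_t] := ann_f j.+1 (leqnn _).
have [|z def_z] := @Koszul_inj j (x j.+1 *: y) t (ltnW ltjN).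
  by rewrite linearZ def_t; apply: KoszulZ.
(* As x_(j+1) f is a boundary, x_(j+1) y has a trivial class; correcting it by the witness [z] makes
   it a cycle, and a preimage of this cycle represents f. *)
pose g l := if l == j.+1 then y else - z l.
pose u := \sum_(l < j.+2) x l *: g l.
have /exact_d[v def_v] : d j u = 0.
  rewrite /u big_ord_recr /= {2}/g eqxx linearD def_z linear_sum -big_split /=.
  by rewrite big1 // => l _; rewrite /g ltn_eqF // linearZ /= linearN scalerN addNr.
by exists v, g; rewrite ?def_v // /g eqxx.
Qed.

(** Multiplying by [x l] makes the class trivial, since x_l d_j y already has the form required by
    [Koszul_boundary]. *)
Lemma Koszul_annihilates j y f l : (j < N)%N -> (l <= j)%N ->
  Koszul (d j y) f -> exists t, d 0%N t = x l *: f.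
Proof.
move=> ltjN lelj /(KoszulZ (x l)); set z := fun l' => if l' == l then y else 0.
suff -> : x l *: d j y = \sum_(l' < j.+1) x l' *: d j (z l').
  exact: Koszul_boundary.
rewrite (bigD1 (Ordinal (lelj : l < j.+1)%N)) //= /z eqxx big1 ?addr0 // => i ne_i.
by rewrite ifN ?linear0 ?scaler0.
Qed.

(** Here [part i c] plays the degree c component of F_i and [e l] the degree of x_l. The accumulated
    shift becomes (1, ..., 1) for the variables. *)
Lemma Koszul_degree_part n (e : nat -> 'X_{1..n})
    (part : forall i, 'X_{1..n} -> F i -> F i) j u f c :
  (forall i c, {morph part i c : u v / u + v}) ->
  (forall i c l u, part i (c + e l)%MM (x l *: u) = x l *: part i c u) ->
  (forall i c v, part i c (d i v) = d i (part i.+1 c v)) ->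
  @Koszul j u f ->
  Koszul (part j (c + \sum_(l < j.+1) e l)%MM u) (part 0%N c f).
Proof.
move=> partD partX part_d; elim: j u => [|j IHj] u /=.
  by move->; rewrite big_ord1 partX.
have part0 i c' : part i c' 0 = 0.
  by apply: (addrI (part i c' 0)); rewrite -partD !addr0.
case=> g -> /IHj Kg.
(* The coefficient of x_l must have degree lower by [e l]; for l = j+1 this is the degree of the
   induction hypothesis. *)
exists (fun l =>
  part j.+1 (c + \sum_(i < j.+2 | i != l :> nat) e i)%MM (g l)).
  rewrite (big_morph _ (partD j.+1 _) (part0 _ _)); apply: eq_bigr => l _.
  by rewrite -partX -addmA; congr (part _ (_ + _)%MM _); rewrite (bigD1 l) //= addmC.
suff -> : (\sum_(i < j.+2 | i != j.+1 :> nat) e i = \sum_(i < j.+1) e i)%MM.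
  by rewrite -part_d.
rewrite big_mkcond big_ord_recr /= eqxx addm0.
by apply: eq_bigr => i _; rewrite ltn_eqF.
Qed.

End Complex.
End RegularSequences.

(** * Projective modules *)

Section FreeModule.
Variables (R : comNzRingType) (K : choiceType).
Local Notation coeff := (@coeff R K).

Fact freeg_coord_is_scalable (q : K) : scalable (coeff q : {freeg K / R} -> R^o).
Proof. by move=> a D; rewrite coeffZ. Qed.

Definition freeg_coord (q : K) : {freeg K / R} -> R^o := coeff q.

HB.instance Definition _ q :=
  GRing.isAdditive.Build {freeg K / R} R^o (freeg_coord q) (coeff_is_additive q).
HB.instance Definition _ q :=
  GRing.isScalable.Build R {freeg K / R} R^o *:%R (freeg_coord q)
    (freeg_coord_is_scalable q).

Variables (V : lmodType R) (b : K -> V).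

Definition freeg_lift (D : {freeg K / R}) : V := fglift b D.

HB.instance Definition _ :=
  GRing.isAdditive.Build {freeg K / R} V freeg_lift (lift_is_additive b).

Lemma freeg_liftE D : freeg_lift D = \sum_(q <- dom D) coeff q D *: b q.
Proof.
rewrite -{1}[D]freeg_sumE raddf_sum; apply: eq_bigr => q _.
exact: liftU.
Qed.

Fact freeg_lift_is_scalable : scalable freeg_lift.
Proof.
move=> a D; rewrite (freeg_liftE D) scaler_sumr.
rewrite [a *: D]/(fgscale a D) raddf_sum; apply: eq_bigr => q _.
by rewrite scalerA; apply: liftU.
Qed.

HB.instance Definition _ :=
  GRing.isScalable.Build R {freeg K / R} V *:%R freeg_lift freeg_lift_is_scalable.

End FreeModule.

Section ProjectiveModules.
Variable R : comNzRingType.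

(* The functionals are the coordinates of a section of the surjection onto P
   from the free module on the set P. *)
Lemma projective_dual_basis (P : lmodType R) : projective P ->
  exists phi : P -> {linear P -> R^o}, forall u, exists s : seq P,
    u = \sum_(q <- s) phi q u *: q.
Proof.
move=> projP.
have [|h hK] := projP {freeg P / R} P (freeg_lift id) idfun.
  by move=> y; exists << y >>; rewrite /= /freeg_lift liftU scale1r.
exists (fun q => freeg_coord q \o h) => u; exists (dom (h u)).
by rewrite -[LHS]hK; apply: freeg_liftE.
Qed.

(** Each functional of a dual basis turns a relation in P into one in R; the coordinates of [g j]
    are then multiples, and so is [g j]. *)
Lemma projective_weakly_regular (x : nat -> R) (P : lmodType R) N :
  projective P -> weakly_regular x R^o N -> weakly_regular x P N.
Proof.
move=> /projective_dual_basis[phi phiE] regR j g ltjN sum0.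
have [s ->] := phiE (g j); apply: in_multiples_sum => q _.
apply: in_multiples_scaler; apply: (regR j (fun l => phi q (g l))) => //.
rewrite -[RHS](linear0 (phi q)) -sum0 linear_sum.
by apply: eq_bigr => l _; rewrite linearZ.
Qed.

Lemma projective_rV r : projective 'rV[R]_r.
Proof.
move=> M N g f surj_g; have [z zP] := choice (fun p => surj_g (f (delta_mx 0 p))).
pose h (u : 'rV[R]_r) : M := \sum_p u 0 p *: z p.
have h_lin : linear h.
  move=> a u v; rewrite /h scaler_sumr -big_split /=; apply: eq_bigr => p _.
  by rewrite !mxE scalerDl scalerA.
exists (HB.pack_for {linear 'rV[R]_r -> M} h (GRing.isLinear.Build _ _ _ _ h h_lin)).
move=> u /=; rewrite /h linear_sum {2}[u]row_sum_delta linear_sum.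
by apply: eq_bigr => p _; rewrite !linearZ /= zP.
Qed.

End ProjectiveModules.

(** * Polynomials *)

Section Polynomials.
Variables (k : fieldType) (n : nat).
Local Notation R := {mpoly k[n]}.

Lemma mcoeffMXE (p : R) m c :
  (p * 'X_[m])@_c = if (m <= c)%MM then p@_(c - m) else 0.
Proof.
case: ifPn => [le_mc|nle_mc]; first by rewrite -{1}(submK le_mc) addmC mcoeffMX.
apply: memN_msupp_eq0; rewrite (perm_mem (msuppMX p m)).
by apply: contra nle_mc => /mapP[m' _ ->]; apply: lem_addr.
Qed.

(** Indexed by naturals to fit the Koszul lemmas; the value 0 from n on is a default. *)
Definition mvar (l : nat) : R := oapp (fun i : 'I_n => 'X_i) 0 (insub l).
Definition mvar_deg (l : nat) : 'X_{1..n} :=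
  oapp (fun i : 'I_n => U_(i)%MM) 0%MM (insub l).

Lemma mvar_ord (i : 'I_n) : mvar i = 'X_i.
Proof. by rewrite /mvar valK. Qed.

Lemma mvar_deg_ord (i : 'I_n) : mvar_deg i = U_(i)%MM.
Proof. by rewrite /mvar_deg valK. Qed.

Lemma in_multiples_msupp (p : R^o) j :
  (forall m, m \in msupp p -> exists2 l : 'I_n, (l < j)%N & (0 < m l)%N) ->
  in_multiples mvar j p.
Proof.
move=> supp_p; rewrite (mpolyE p); apply: in_multiples_sum => m /supp_p[l ltlj ml].
rewrite -(@submK _ U_(l) m) ?lep1mP -?lt0n // mpolyXD scalerAl mulrC -mvar_ord.
exact: (@in_multiples1 _ mvar R^o _ _ (_ *: 'X_[_])).
Qed.

(** If a monomial m of [g j] involved no x_l with l < j, then x_j m could arise in the relation only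
    from x_j [g j], and would not cancel. *)
Lemma mpoly_weakly_regular : weakly_regular mvar R^o n.
Proof.
move=> j g ltjn sum0; apply: in_multiples_msupp => m supp_m; apply/exists2P.
apply: contrapT => no_l.
have m0 l (ltln : (l < n)%N) : (l < j)%N -> m (Ordinal ltln) = 0%N.
  move=> ltlj; apply/eqP; rewrite -leqn0 leqNgt; apply/negP => m_gt0.
  by apply: no_l; exists (Ordinal ltln).
have /(congr1 (mcoeff (U_(Ordinal ltjn) + m)%MM)) := sum0.
rewrite big_ord_recr mcoeffD raddf_sum /= mcoeff0 big1 ?add0r.
  rewrite [mvar j](mvar_ord (Ordinal ltjn)) [_ *: _]mulrC mcoeffMX.
  by move/eqP; rewrite mcoeff_eq0 supp_m.
move=> [l ltlj] _ /=; have ltln := ltn_trans ltlj ltjn.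
rewrite [mvar l](mvar_ord (Ordinal ltln)) [_ *: _]mulrC mcoeffMXE ifN //.
rewrite lep1mP mnmDE m0 // mnm1E addn0 negbK eqb0 -val_eqE /=.
by rewrite gtn_eqF.
Qed.

Lemma in_multiples_mcoeff0 r (u : 'rV[R]_r) :
  (forall p, (u 0 p)@_0%MM = 0) -> in_multiples mvar n u.
Proof.
move=> u0; rewrite (row_sum_delta u); apply: in_multiples_sum => p _.
apply/in_multiples_scaler/in_multiples_msupp => m supp_m.
have /eqP : m != 0%MM.
  by apply: contraTneq supp_m => ->; rewrite -mcoeff_eq0 u0.
move=> ne0; apply/exists2P; apply: contrapT => no_l; apply: ne0.
apply/mnmP => l; rewrite mnm0E; apply/eqP; rewrite -leqn0 leqNgt; apply/negP => ?.
by apply: no_l; exists l.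
Qed.

Lemma in_multiples_mcoeff0P r (u : 'rV[R]_r) p :
  in_multiples mvar n u -> (u 0 p)@_0%MM = 0.
Proof.
move=> [g ->]; rewrite summxE raddf_sum big1 // => l _.
rewrite mxE mvar_ord mulrC [LHS]mcoeffMXE ifN //.
by rewrite lep1mP mnm0E.
Qed.

End Polynomials.

(** * Monomial ideals and edge ideals *)

Section MonomialIdeals.
Variables (k : fieldType) (n : nat).
Local Notation R := {mpoly k[n]}.

Definition in_monomial_ideal (ms : seq 'X_{1..n}) (m : 'X_{1..n}) :=
  has (fun g => g <= m)%MM ms.

Lemma ideal_gen_sum (s : seq R) (I : eqType) (r : seq I) (f : I -> R) :
  {in r, forall i, f i \in ideal_gen s} -> \sum_(i <- r) f i \in ideal_gen s.
Proof. by move=> sf; rewrite big_seq; apply: rpred_sum. Qed.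

Lemma ideal_gen_monomialP (ms : seq 'X_{1..n}) (f : R) :
  reflect {in msupp f, forall m, in_monomial_ideal ms m}
          (f \in ideal_gen [seq 'X_[m] | m <- ms]).
Proof.
apply: (iffP idP) => [/ideal_genP[c ->] m|supp_f].
  apply: contraTT => /hasPn no_g; rewrite -mcoeff_eq0 raddf_sum big1 // => i _.
  have lti : (i < size ms)%N by have := ltn_ord i; rewrite {2}size_map.
  by rewrite (nth_map 0%MM) // [LHS]mcoeffMXE ifN // no_g ?mem_nth.
rewrite (mpolyE f); apply: ideal_gen_sum => m /supp_f/hasP[g ms_g le_gm].
rewrite -(submK le_gm) mpolyXD scalerAl; apply: ideal_gen_mull; apply/ideal_genP.
have ltg : (index 'X_[g] [seq 'X_[k, m] | m <- ms] <
            size [seq 'X_[k, m] | m <- ms])%N.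
  by rewrite index_mem map_f.
exists (fun i => (i == Ordinal ltg)%:R).
rewrite (bigD1 (Ordinal ltg)) //= eqxx mul1r nth_index ?map_f // big1 ?addr0 //.
by move=> i /negPf ->; rewrite mul0r.
Qed.

Lemma mcoeff_mulX_ord (f : R) (i : 'I_n) m : (mvar k n i * f)@_(m + U_(i)) = f@_m.
Proof. by rewrite mvar_ord mulrC addmC mcoeffMX. Qed.

End MonomialIdeals.

Section EdgeIdeals.
Variables (k : fieldType) (n : nat) (D : wograph n).
Local Notation w := (weight D).

Definition edge_monomials : seq 'X_{1..n} :=
  [seq (U_(e.1) + U_(e.2) *+ w e.2)%MM
     | e <- enum [pred e : 'I_n * 'I_n | oedge D e.1 e.2]].

Lemma edge_ideal_gensE :
  edge_ideal_gens k D = [seq 'X_[m] | m <- edge_monomials].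
Proof.
rewrite /edge_monomials -map_comp; apply: eq_map => e /=.
by rewrite mpolyXD mpolyXn.
Qed.

Lemma oedge_neq x y : oedge D x y -> (x == y) = false.
Proof. by apply: contraTF => /eqP ->; rewrite oedge_irrefl. Qed.

Lemma in_edge_idealP (m : 'X_{1..n}) :
  reflect (exists x y, [/\ oedge D x y, 0 < m x & w y <= m y]%N)
          (in_monomial_ideal edge_monomials m).
Proof.
apply: (iffP hasP) => [[_ /mapP[[x y] + ->] /mnm_lepP le_m]|[x [y [xy mx my]]]].
  rewrite mem_enum inE /= => xy; exists x, y; split=> //=.
    by apply: leq_trans (le_m x); rewrite mnmDE mnm1E /= eqxx.
  apply: leq_trans (le_m y); rewrite mnmDE mulmnE !mnm1E /= eqxx mul1n.
  exact: leq_addl.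
exists (U_(x) + U_(y) *+ w y)%MM.
  by apply/mapP; exists (x, y) => //; rewrite mem_enum inE.
apply/mnm_lepP => z; rewrite mnmDE mulmnE !mnm1E.
have [<-|_] := eqVneq x z.
  by rewrite eq_sym (oedge_neq xy).
by have [<-|_] := eqVneq y z; rewrite ?mul1n.
Qed.

Definition socle_monomial : 'X_{1..n} := [multinom (w i).-1 | i < n].

Lemma socle_monomial_notin : ~~ in_monomial_ideal edge_monomials socle_monomial.
Proof.
apply/in_edge_idealP => -[x [y [_ _]]]; rewrite mnmE leqNgt ltn_predL.
by rewrite weight_gt0.
Qed.

Lemma socle_monomial_mul :
  (forall i, exists j, oedge D j i /\ (1 < w j)%N) ->
  forall i, in_monomial_ideal edge_monomials (socle_monomial + U_(i))%MM.
Proof.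
move=> C i; have [j [ji wj]] := C i; apply/in_edge_idealP; exists j, i; split=> //.
  by rewrite mnmDE mnmE addn_gt0 -ltnS prednK ?wj // weight_gt0.
by rewrite mnmDE mnmE mnm1E eqxx addn1 prednK // weight_gt0.
Qed.

Lemma socle_condition (m : 'X_{1..n}) :
  ~~ in_monomial_ideal edge_monomials m ->
  (forall i, in_monomial_ideal edge_monomials (m + U_(i))%MM) ->
  forall i, exists j, oedge D j i /\ (1 < w j)%N.
Proof.
move=> /in_edge_idealP notin_m in_mU.
(* The edge dividing x_i m must point towards x_i: an edge (x_i, x_j) would
   force w_j <= m_j, and then no edge can divide x_j m but not m. *)
have {in_mU} in_mU i : (exists j, [/\ oedge D j i, 0 < m j & m i < w i]%N) \/
    (exists j, [/\ oedge D i j, m i = 0 & w j <= m j]%N).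
  have /in_edge_idealP[x [y []]] := in_mU i.
  rewrite !mnmDE !mnm1E; have [<-|ne_ix] := eqVneq i x.
    move=> iy _; rewrite (oedge_neq iy) addn0 => my; right; exists y; split=> //.
    by apply/eqP; rewrite -leqn0 leqNgt; apply/negP => ?; apply: notin_m; exists i, y.
  rewrite addn0; have [<-|_] := eqVneq i y => xy mx my; last first.
    by case: notin_m; exists x, y; rewrite addn0 in my.
  left; exists x; split=> //.
  by rewrite ltnNge; apply/negP => ?; apply: notin_m; exists x, i.
have towards i : exists j, [/\ oedge D j i, 0 < m j & m i < w i]%N.
  case: (in_mU i) => // -[j [_ _ wj]].
  case: (in_mU j) => [[l [_ _]]|[l [_ mj _]]]; first by rewrite ltnNge wj.
  by move: wj; rewrite mj leqNgt weight_gt0.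
(* The edge towards j gives m_j < w_j, which together with 0 < m_j makes w_j non-trivial. *)
move=> i; have [j [ji mj _]] := towards i; exists j; split=> //.
by have [_ [_ _]] := towards j; apply: leq_ltn_trans.
Qed.

End EdgeIdeals.

(** * Projective dimension *)

Lemma quot_classZ (R : comNzRingType) (s : seq R) (a f : R) :
  a *: quot_class s f = quot_class s (a * f).
Proof. exact: quot_scale_class. Qed.

Lemma quot_class_eq0 (R : comNzRingType) (s : seq R) (f : R) :
  quot_class s f = 0 <-> f \in ideal_gen s.
Proof.
have := quot_classZ s 0 0; rewrite mul0r scale0r => ->.
by rewrite -{2}[f]subr0 -quot_class_eq; split=> [->|/eqP].
Qed.

Section Resolutions.
Variables (k : fieldType) (n : nat).
Local Notation R := {mpoly k[n]}.
Implicit Type s : seq R.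

Lemma projective_mpoly_regular (P : lmodType R) :
  projective P -> weakly_regular (mvar k n) P n.
Proof. by move/projective_weakly_regular; apply; apply: mpoly_weakly_regular. Qed.

(** A socle element outside the ideal gives a nonzero class in Tor_n, represented by an element of
    the n-th term; a resolution shorter than n has no such element. *)
Lemma pdim_ge_socle s f e :
  f \notin ideal_gen s -> (forall i : 'I_n, mvar k n i * f \in ideal_gen s) ->
  pdim_le (quot_ideal s) e -> (n <= e)%N.
Proof.
move=> notin_f socle_f [P P0]; rewrite leqNgt; apply/negP => lten.
have [f0 aug_f0] := pres_aug_surj P (quot_class s f).
have aug_quot a : pres_aug P (a *: f0) = quot_class s (a * f).
  by rewrite linearZ aug_f0 -quot_classZ.
have reg_P i := projective_mpoly_regular (pres_projective (p := P) (i := i)).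
have n_gt0 : (0 < n)%N by apply: leq_ltn_trans lten.
have ltn : (n.-1 < n)%N by rewrite ltn_predL.
have [|y Ky] := Koszul_surj (pres_exactS (p := P)) reg_P ltn (f := f0).
  move=> l; rewrite -ltnS prednK // => ltln.
  apply/pres_exact0; rewrite aug_quot; apply/quot_class_eq0.
  exact: (socle_f (Ordinal ltln)).
have y0 : y = 0 by apply: P0; rewrite prednK.
have := @Koszul_boundary _ _ _ _ _ (pres_exactS (p := P)) reg_P n.-1 f0 (fun=> 0) ltn.
rewrite big1 => [|l _]; last by rewrite linear0 scaler0.
move: Ky; rewrite y0 linear0 => Ky /(_ Ky)/pres_exact0.
by rewrite aug_f0 => /quot_class_eq0; apply/negP.
Qed.

(** * Vanishing of terms in minimal resolutions *)

Section MinimalResolutions.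
Variables (s : seq R) (F : minimal_free_resolution s).

Definition mfr_map i : {linear 'rV[R]_(mfr_rank F i.+1) -> 'rV[R]_(mfr_rank F i)} :=
  mulmxr (mfr_diff F i).

Lemma mfr_mapE i u : mfr_map i u = u *m mfr_diff F i.
Proof. by []. Qed.

Lemma mfr_map_exact i u : mfr_map i u = 0 <-> exists v, mfr_map i.+1 v = u.
Proof. by rewrite (mfr_exactS u); split=> -[v def_u]; exists v. Qed.

Lemma mfr_regular i : weakly_regular (mvar k n) 'rV[R]_(mfr_rank F i) n.
Proof. exact/projective_mpoly_regular/projective_rV. Qed.

Lemma mfr_map_mcoeff0 i (u : 'rV[R]_(mfr_rank F i.+1)) p :
  (mfr_map i u 0 p)@_0%MM = 0.
Proof.
rewrite mfr_mapE mxE raddf_sum big1 // => q _ /=.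
by rewrite rmorphM /= mfr_minimal mulr0.
Qed.

Lemma mfr_map_in_multiples i (u : 'rV[R]_(mfr_rank F i.+1)) :
  in_multiples (mvar k n) n (mfr_map i u).
Proof. exact/in_multiples_mcoeff0/mfr_map_mcoeff0. Qed.

(* Nakayama's lemma for the image of the differential. *)
Lemma mfr_rank_eq0 i :
  (forall y, exists z : nat -> 'rV[R]_(mfr_rank F i.+1),
     mfr_map i y = \sum_(l < n) mvar k n l *: mfr_map i (z l)) ->
  mfr_rank F i.+1 = 0%N.
Proof.
move=> im_mult; case: (posnP (mfr_rank F i.+1)) => // rank_gt0.
pose p := Ordinal rank_gt0; have [z def_z] := im_mult (delta_mx 0 p).
have /mfr_map_exact[v /rowP/(_ p)/(congr1 (mcoeff 0%MM))] :
    mfr_map i (delta_mx 0 p - \sum_(l < n) mvar k n l *: z l) = 0.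
  by rewrite linearB def_z linear_sum -sumrB big1 // => l _; rewrite linearZ subrr.
rewrite mfr_map_mcoeff0 mxE mcoeffD mxE !eqxx mcoeff1 eqxx mxE mcoeffN.
rewrite in_multiples_mcoeff0P ?subr0; last by exists z.
by move/eqP; rewrite eq_sym oner_eq0.
Qed.

(** By minimality all boundaries are multiples of the variables; for i > n the vanishing of Koszul
    homology feeds this into Nakayama's lemma. *)
Lemma mfr_rank_gt i : (n < i)%N -> mfr_rank F i = 0%N.
Proof.
case: i => // i; rewrite ltnS => leni; apply: mfr_rank_eq0 => y.
exact: (image_in_multiples mfr_map_exact mfr_regular leni (leqnn n)
         (mfr_map_in_multiples y)).
Qed.

Definition mfr_augment (u : 'rV[R]_(mfr_rank F 0)) : quot_ideal s :=
  quot_class s ((u *m mfr_aug F) 0 0).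

Lemma mfr_augment_eq0 u : mfr_augment u = 0 <-> exists v, mfr_map 0 v = u.
Proof.
rewrite /mfr_augment quot_class_eq0 (mfr_exact0 u).
by split=> -[v def_u]; exists v.
Qed.

Fact mfr_augment_is_linear : linear mfr_augment.
Proof.
move=> a u v; rewrite /mfr_augment mulmxDl -scalemxAl 2!mxE quot_classD.
by rewrite quot_classZ.
Qed.

HB.instance Definition _ :=
  GRing.isLinear.Build R 'rV[R]_(mfr_rank F 0) (quot_ideal s) *:%R mfr_augment
    mfr_augment_is_linear.

Lemma mfr_augmentZ a u : mfr_augment (a *: u) = a *: mfr_augment u.
Proof. exact: linearZ. Qed.

Lemma mfr_augment_surj y : exists u, mfr_augment u = y.
Proof.
have [f ->] := quot_classP y; have [u] := mfr_aug_surj F f.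
by rewrite -quot_class_eq => /eqP; exists u.
Qed.

Definition mfr_projective_resolution : projective_resolution (quot_ideal s) :=
  @ProjectiveResolution R (quot_ideal s) (fun i => 'rV[R]_(mfr_rank F i)) mfr_map
    mfr_augment (fun i => @projective_rV R _) mfr_augment_surj mfr_augment_eq0
    mfr_map_exact.

Lemma mfr_pdim_le d : (forall i, (d < i)%N -> mfr_rank F i = 0%N) ->
  pdim_le (quot_ideal s) d.
Proof.
move=> rank0; exists mfr_projective_resolution => i /rank0 /= rank_i u.
by apply/rowP => p; have := ltn_ord p; rewrite {2}rank_i.
Qed.

(** The partner of a top class is killed by all variables. Without a socle it is zero, so every top
    class is trivial and Nakayama's lemma applies. *)
Lemma mfr_top_rank_eq0 : (0 < n)%N ->
  (forall f, (forall i : 'I_n, mvar k n i * f \in ideal_gen s) ->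
     f \in ideal_gen s) ->
  mfr_rank F n = 0%N.
Proof.
move=> n_gt0 no_socle; have ltn : (n.-1 < n)%N by rewrite ltn_predL.
suff : mfr_rank F n.-1.+1 = 0%N by rewrite prednK.
apply: mfr_rank_eq0 => y.
(* The length is generalised to [j] because rewriting n itself would also change the polynomial
   ring. *)
have mult_y j : j = n -> in_multiples (mvar k n) j (mfr_map n.-1 y).
  by move->; apply: mfr_map_in_multiples.
have /mult_y : n.-1.+1 = n by rewrite prednK.
case/(Koszul_exists mfr_map_exact mfr_regular ltn) => f Kf.
have [] : exists t, mfr_map 0 t = f.
  apply/mfr_augment_eq0/quot_class_eq0; apply: no_socle => i.
  have lei : (i <= n.-1)%N by rewrite -ltnS prednK.
  have := Koszul_annihilates mfr_map_exact mfr_regular ltn lei Kf.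
  by move/mfr_augment_eq0/quot_class_eq0; rewrite -scalemxAl mxE.
move=> t def_t; move: Kf; rewrite -def_t.
case/(Koszul_inj mfr_map_exact mfr_regular ltn) => z ->; exists z.
have sumE j : j = n -> \sum_(l < j) mvar k n l *: mfr_map n.-1 (z l) =
  \sum_(l < n) mvar k n l *: mfr_map n.-1 (z l) by move->.
by apply: sumE; rewrite prednK.
Qed.

End MinimalResolutions.
End Resolutions.

(** * Graded free modules *)

Section GradedFreeModules.
Variables (k : fieldType) (n : nat).
Local Notation R := {mpoly k[n]}.
Implicit Types c m : 'X_{1..n}.

(* Setting all variables to 1 identifies the degree c part of the graded free
   module with generators of degrees d p with the vectors over k supported on
   the generators p such that d p <= c; homog_row and graded_mx undo this for
   vectors and for matrices. *)
Definition supported r (d : 'I_r -> 'X_{1..n}) c (v : 'rV[k]_r) : Prop :=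
  forall p, v 0 p != 0 -> (d p <= c)%MM.

Definition comp_row r (d : 'I_r -> 'X_{1..n}) c (u : 'rV[R]_r) : 'rV[k]_r :=
  \row_p (if (d p <= c)%MM then (u 0 p)@_(c - d p) else 0).

Definition homog_row r (d : 'I_r -> 'X_{1..n}) c (v : 'rV[k]_r) : 'rV[R]_r :=
  \row_p (v 0 p *: 'X_[c - d p]).

Definition graded r r' (d' : 'I_r' -> 'X_{1..n}) (d : 'I_r -> 'X_{1..n})
    (L : 'M[k]_(r', r)) : Prop :=
  forall p q, L p q != 0 -> (d q <= d' p)%MM.

Definition graded_mx r r' (d' : 'I_r' -> 'X_{1..n}) (d : 'I_r -> 'X_{1..n})
    (L : 'M[k]_(r', r)) : 'M[R]_(r', r) :=
  \matrix_(p, q) (L p q *: 'X_[d' p - d q]).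

Lemma comp_row_supported r (d : 'I_r -> 'X_{1..n}) c u : supported d c (comp_row d c u).
Proof. by move=> p; rewrite mxE; case: ifP => //; rewrite eqxx. Qed.

Lemma comp_rowD r (d : 'I_r -> 'X_{1..n}) c : {morph comp_row d c : u v / u + v}.
Proof.
move=> u v; apply/rowP => p; rewrite !mxE mcoeffD.
by case: ifP; rewrite ?addr0.
Qed.

Lemma homog_rowD r (d : 'I_r -> 'X_{1..n}) c : {morph homog_row d c : u v / u + v}.
Proof. by move=> u v; apply/rowP => p; rewrite !mxE scalerDl. Qed.

Lemma homog_row_sum r (d : 'I_r -> 'X_{1..n}) c (I : Type) (s : seq I) (F : I -> 'rV[k]_r) :
  homog_row d c (\sum_(i <- s) F i) = \sum_(i <- s) homog_row d c (F i).
Proof.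
apply: (big_morph _ (homog_rowD d c)).
by apply/rowP => p; rewrite !mxE scale0r.
Qed.

Lemma subm_sub c a b : (a <= b)%MM -> (b <= c)%MM ->
  (c - a - (b - a) = c - b)%MM.
Proof. by move=> le_ab le_bc; rewrite submDA addmC submK. Qed.

Lemma comp_row_mulmx r r' (d' : 'I_r' -> 'X_{1..n}) (d : 'I_r -> 'X_{1..n}) L c u :
  graded d' d L -> comp_row d c (u *m graded_mx d' d L) = comp_row d' c u *m L.
Proof.
move=> gL; apply/rowP => q; rewrite !mxE raddf_sum /=.
have [le_qc|nle_qc] := ifPn; last first.
  rewrite big1 // => p _; rewrite mxE; have [->|/gL le_qp] := eqVneq (L p q) 0.
    by rewrite mulr0.
  by rewrite ifN ?mul0r //; apply: contra nle_qc; apply: lepm_trans.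
apply: eq_bigr => p _; rewrite !mxE -scalerAr mcoeffZ mcoeffMXE [RHS]mulrC.
have [->|/gL le_qp] := eqVneq (L p q) 0; first by rewrite !mul0r.
congr (_ * _); have [le_pc|nle_pc] := boolP (d' p <= c)%MM.
  rewrite subm_sub // ifT //; apply/mnm_lepP => i; rewrite !mnmBE.
  by apply: leq_sub2r; move/mnm_lepP: le_pc.
(* Subtraction of exponents is truncated, but [d q] lies below both [d' p] and [c], so no truncation
   occurs. *)
rewrite ifN //; apply: contra nle_pc => /mnm_lepP le_B; apply/mnm_lepP => i.
have := le_B i; rewrite !mnmBE leq_subLR subnKC //.
by move/mnm_lepP: le_qc.
Qed.

Lemma homog_row_mulmx r r' (d' : 'I_r' -> 'X_{1..n}) (d : 'I_r -> 'X_{1..n}) L c v :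
  graded d' d L -> supported d' c v ->
  homog_row d' c v *m graded_mx d' d L = homog_row d c (v *m L).
Proof.
move=> gL sv; apply/rowP => q; rewrite !mxE scaler_suml.
apply: eq_bigr => p _; rewrite !mxE -scalerAl -scalerAr scalerA.
have [->|/gL le_qp] := eqVneq (L p q) 0; first by rewrite mulr0 !scale0r.
have [->|/sv le_pc] := eqVneq (v 0 p) 0; first by rewrite mul0r !scale0r.
congr (_ *: _); rewrite -mpolyXD; congr 'X_[_]; apply/mnmP => i.
rewrite mnmDE !mnmBE addnBA; last by move/mnm_lepP: le_qp.
by rewrite subnK //; move/mnm_lepP: le_pc.
Qed.

Lemma sum_homog_comp r (d : 'I_r -> 'X_{1..n}) (u : 'rV[R]_r) :
  exists S : seq 'X_{1..n}, u = \sum_(c <- S) homog_row d c (comp_row d c u).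
Proof.
(* All degrees of terms of [u], shifted by the generator; [undup] makes each component occur
   once. *)
pose S := undup (flatten [seq [seq (m + d p)%MM | m <- msupp (u 0 p)] | p : 'I_r]).
exists S; apply/rowP => p; rewrite summxE; apply/mpolyP => m; rewrite raddf_sum /=.
have term0 c : c != (m + d p)%MM -> (homog_row d c (comp_row d c u) 0 p)@_m = 0.
  move=> ne_c; rewrite !mxE mcoeffZ mcoeffX; have [le_pc|_] := ifPn; rewrite ?mul0r //.
  by case: eqP => [def_m|_]; rewrite ?mulr0 //; rewrite -def_m submK ?eqxx in ne_c.
have termE :
    (homog_row d (m + d p)%MM (comp_row d (m + d p)%MM u) 0 p)@_m = (u 0 p)@_m.
  by rewrite !mxE lem_addl addmK mcoeffZ mcoeffX eqxx mulr1.
have [S_m|notS_m] := boolP ((m + d p)%MM \in S).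
  by rewrite (bigD1_seq _ S_m) ?undup_uniq //= termE big1 ?addr0.
rewrite big_seq big1 => [|c S_c]; last first.
  by apply: term0; apply: contraNneq notS_m => <-.
apply: memN_msupp_eq0; apply: contra notS_m => supp_m; rewrite mem_undup.
by apply/flatten_imageP; exists p => //; apply/mapP; exists m.
Qed.

Definition degree_part r (d : 'I_r -> 'X_{1..n}) c (u : 'rV[R]_r) :=
  homog_row d c (comp_row d c u).

Lemma degree_partD r (d : 'I_r -> 'X_{1..n}) c : {morph degree_part d c : u v / u + v}.
Proof. by move=> u v; rewrite /degree_part comp_rowD homog_rowD. Qed.

Lemma degree_part_mulmx r r' (d' : 'I_r' -> 'X_{1..n}) (d : 'I_r -> 'X_{1..n}) L c u :
  graded d' d L ->
  degree_part d c (u *m graded_mx d' d L) = degree_part d' c u *m graded_mx d' d L.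
Proof.
by move=> gL; rewrite /degree_part comp_row_mulmx // homog_row_mulmx //; apply: comp_row_supported.
Qed.

Lemma degree_partX r (d : 'I_r -> 'X_{1..n}) c l u :
  degree_part d (c + mvar_deg n l)%MM (mvar k n l *: u) =
  mvar k n l *: degree_part d c u.
Proof.
rewrite /mvar /mvar_deg; case: insub => [i|] /=; last first.
  by rewrite !scale0r; apply/rowP => p; rewrite !mxE mcoeff0 if_same scale0r.
apply/rowP => p; rewrite !mxE mulrC mcoeffMXE.
have [le_pc|nle_pc] := boolP (d p <= c)%MM.
  have le_pc' : (d p <= c + U_(i))%MM by apply: lepm_trans le_pc (lem_addr _ _).
  have -> : (c + U_(i) - d p = (c - d p) + U_(i))%MM.
    apply/mnmP => j; rewrite !(mnmDE, mnmBE) addnBAC //; exact: (mnm_lepP le_pc j).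
  by rewrite le_pc' lem_addl addmK mpolyXD [RHS]mulrC scalerAl.
(* Here [d p] lies below c + U_i but not below c, so x_i is absent from the quotient monomial and
   both sides vanish. *)
rewrite scale0r mulr0; case: ifP => [le_pc'|_]; last by rewrite scale0r.
rewrite ifN ?scale0r //; apply: contra nle_pc => /mnm_lepP le_i.
apply/mnm_lepP => j; move: (le_i j) (mnm_lepP le_pc' j); rewrite !(mnmDE, mnmBE).
by rewrite mnm1E; case: eqP => _; rewrite ?addn0 // addn1 subn_gt0 ltnS.
Qed.

(** Homogeneity leaves at most one monomial per entry, so only a scalar has to be remembered. *)
Lemma graded_mxP r r' (d' : 'I_r' -> 'X_{1..n}) (d : 'I_r -> 'X_{1..n})
    (A : 'M[R]_(r', r)) :
  (forall p q m, m \in msupp (A p q) -> (m + d q)%MM = d' p) ->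
  exists2 L, graded d' d L & A = graded_mx d' d L.
Proof.
move=> homA.
exists (\matrix_(p, q) if (d q <= d' p)%MM then (A p q)@_(d' p - d q) else 0).
  by move=> p q; rewrite mxE; case: ifP; rewrite ?eqxx.
apply/matrixP => p q; rewrite !mxE; apply/mpolyP => m; rewrite mcoeffZ mcoeffX.
have [Am|notAm] := boolP (m \in msupp (A p q)).
  by rewrite -(homA p q m Am) lem_addl addmK eqxx mulr1.
rewrite (memN_msupp_eq0 notAm); case: eqP => [def_m|_]; last by rewrite mulr0.
by rewrite def_m (memN_msupp_eq0 notAm) if_same mul0r.
Qed.

End GradedFreeModules.

(** * Degrees of the top syzygies *)

Section TopDegree.
Variables (k : fieldType) (n : nat) (ms : seq 'X_{1..n}).
Local Notation R := {mpoly k[n]}.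
Local Notation s := [seq 'X_[k, m] | m <- ms].
Variable F : minimal_free_resolution s.

Lemma mfr_map_degree_part i c (u : 'rV[R]_(mfr_rank F i.+1)) :
  degree_part (@mfr_deg _ _ _ F i) c (mfr_map F i u) =
  mfr_map F i (degree_part (@mfr_deg _ _ _ F i.+1) c u).
Proof.
have [L gL def_d] := graded_mxP (@mfr_diff_homog _ _ _ F i).
by rewrite !mfr_mapE def_d degree_part_mulmx.
Qed.

Lemma mfr_augment_degree_part c (u : 'rV[R]_(mfr_rank F 0)) :
  (degree_part (@mfr_deg _ _ _ F 0) c u *m mfr_aug F) 0 0 =
  ((u *m mfr_aug F) 0 0)@_c *: 'X_[c].
Proof.
have [|L gL def_aug] :=
  @graded_mxP k n _ _ (@mfr_deg _ _ _ F 0) (fun=> 0%MM) (mfr_aug F).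
  by move=> p q m; rewrite ord1 addm0 => /mfr_aug_homog.
rewrite def_aug -degree_part_mulmx // !mxE ifT ?subm0 //.
by apply/mnm_lepP => i; rewrite mnm0E.
Qed.

(** The element representing the socle class is cut down to degree m + (1, ..., 1). A unit
    coordinate there exhibits the generator; without one the class would be trivial and x^m would
    lie in the ideal. *)
Lemma mfr_top_degree m : (0 < n)%N ->
  ~~ in_monomial_ideal ms m -> (forall i, in_monomial_ideal ms (m + U_(i))%MM) ->
  exists p : 'I_(mfr_rank F n), mfr_deg p = (m + \sum_i U_(i))%MM.
Proof.
move=> n_gt0 notin_m in_mU; have ltn : (n.-1 < n)%N by rewrite ltn_predL.

have notin_Xm : 'X_[m] \notin ideal_gen s.
  apply: contra notin_m => /ideal_gen_monomialP; apply.
  by rewrite msuppX inE.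
suff [p def_p] : exists p : 'I_(mfr_rank F n.-1.+1),
    mfr_deg p = (m + \sum_(l < n.-1.+1) mvar_deg n l)%MM.
  have castE j : j.+1 = n -> forall p : 'I_(mfr_rank F j.+1),
      mfr_deg p = (m + \sum_(l < j.+1) mvar_deg n l)%MM ->
      exists p : 'I_(mfr_rank F n), mfr_deg p = (m + \sum_i U_(i))%MM.
    move=> def_n; rewrite def_n => {}p {}def_p; exists p; rewrite def_p.
    by congr (_ + _)%MM; apply: eq_bigr => i _; apply: mvar_deg_ord.
  by apply: castE def_p; rewrite prednK.
set c := (_ + _)%MM.
have [f aug_f] := mfr_augment_surj F (quot_class s 'X_[m]).
have [|y Ky] :=
  Koszul_surj (@mfr_map_exact _ _ _ F) (@mfr_regular _ _ _ F) ltn (f := f).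
  move=> l; rewrite -ltnS prednK // => ltln.
  apply/mfr_augment_eq0; rewrite mfr_augmentZ aug_f quot_classZ; apply/quot_class_eq0.
  apply/ideal_gen_monomialP => m' /=; rewrite [mvar k n l](mvar_ord k (Ordinal ltln)).
  by rewrite -mpolyXD addmC msuppX inE => /eqP ->.
have := Koszul_degree_part (e := mvar_deg n) m
  (fun i => @degree_partD _ _ _ (@mfr_deg _ _ _ F i))
  (fun i => @degree_partX _ _ _ (@mfr_deg _ _ _ F i))
  mfr_map_degree_part Ky.
rewrite mfr_map_degree_part -/c; set f_m := degree_part _ _ f => Kc.
case: (pselect (forall p, (degree_part (@mfr_deg _ _ _ F n.-1.+1) c y 0 p)@_0%MM = 0)).
  case/in_multiples_mcoeff0 => z def_z; case/negP: notin_Xm.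
  have [|t def_t] := @Koszul_boundary _ _ _ _ _ (@mfr_map_exact _ _ _ F)
      (@mfr_regular _ _ _ F) n.-1 f_m z ltn.
    suff -> : \sum_(l < n.-1.+1) mvar k n l *: mfr_map F n.-1 (z l) =
        mfr_map F n.-1 (degree_part (@mfr_deg _ _ _ F n.-1.+1) c y) by [].
    have sumE j : j = n -> \sum_(l < j) mvar k n l *: mfr_map F n.-1 (z l) =
        \sum_(l < n) mvar k n l *: mfr_map F n.-1 (z l) by move->.
    rewrite (sumE n.-1.+1) ?prednK // def_z linear_sum.
    by apply: eq_bigr => l _; rewrite linearZ.
  have : mfr_augment f_m = 0 by apply/mfr_augment_eq0; exists t.
  move/quot_class_eq0; rewrite mfr_augment_degree_part.
  (* The augmentation of [f] differs from x^m by an element of the ideal, in which the monomial m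
     cannot occur. *)
  suff -> : ((f *m mfr_aug F) 0 0)@_m = 1 by rewrite scale1r.
  move/eqP: aug_f; rewrite quot_class_eq => /ideal_gen_monomialP in_I.
  apply/eqP; rewrite -subr_eq0; apply: contraR notin_m => ne0; apply: in_I.
  by rewrite mcoeff_msupp mcoeffB mcoeffX eqxx.
(* A nonzero constant term in a component of degree [c] forces generator [p] to have degree exactly
   [c]. *)
case/existsNP => p ne0; exists p; move: ne0; rewrite !mxE mcoeffZ mcoeffX.
have [le_pc|_] := ifPn; last by rewrite mul0r.
by case: eqP => [sub0 _|]; rewrite ?mulr0 // -(submK le_pc) sub0 add0m.
Qed.

End TopDegree.

(** * Minimal free resolutions of monomial ideals *)

Section Existence.
Variables (k : fieldType) (n : nat).
Local Notation R := {mpoly k[n]}.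
Implicit Types (B c : 'X_{1..n}).

(* A graded free module with a graded submodule, dehomogenised: the degree c
   part of the submodule is the row space of gsub_mx c. *)
Record gsub := GSub {
  gsub_rank : nat;
  gsub_deg : 'I_gsub_rank -> 'X_{1..n};
  gsub_mx : 'X_{1..n} -> 'M[k]_gsub_rank
}.
Implicit Types M : gsub.

Definition minm c B : 'X_{1..n} := [multinom minn (c i) (B i) | i < n].

Lemma lem_minm m c B : (m <= minm c B)%MM = (m <= c)%MM && (m <= B)%MM.
Proof.
apply/mnm_lepP/andP => [le_m|[/mnm_lepP le_mc /mnm_lepP le_mB] i].
  by split; apply/mnm_lepP => i; have := le_m i; rewrite mnmE leq_min => /andP[].
by rewrite mnmE leq_min le_mc le_mB.
Qed.

(* The submodule sits inside the maximal ideal times the free module and is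
   generated in degrees below B. *)
Record bounded_gsub B M : Prop := BoundedGSub {
  gsub_deg_le : forall p, (gsub_deg (g := M) p <= B)%MM;
  gsub_supp : forall c (v : 'rV_(gsub_rank M)) p, (v <= gsub_mx M c)%MS ->
    v 0 p != 0 -> (gsub_deg p <= c)%MM && (gsub_deg p != c);
  gsub_mono : forall c c' (v : 'rV_(gsub_rank M)), (c <= c')%MM ->
    (v <= gsub_mx M c)%MS -> (v <= gsub_mx M c')%MS;
  gsub_minm : forall c (v : 'rV_(gsub_rank M)),
    (v <= gsub_mx M c)%MS -> (v <= gsub_mx M (minm c B))%MS
}.

Record generates M r (d : 'I_r -> 'X_{1..n}) (L : 'M[k]_(r, gsub_rank M)) : Prop :=
  Generates {
  generates_row : forall p, (row p L <= gsub_mx M (d p))%MS;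
  generates_sub : forall c (v : 'rV_(gsub_rank M)), (v <= gsub_mx M c)%MS ->
    exists2 a, supported d c a & v = a *m L
}.

(** Every degree is truncated to one below [B], of which there are finitely many; the rows of
    [gsub_mx] in these degrees generate. *)
Lemma generates_exists B M : bounded_gsub B M ->
  exists r (d : 'I_r -> 'X_{1..n}) L,
    (forall p, (d p <= B)%MM) /\ @generates M r d L.
Proof.
case=> _ _ mono minB.
pose T : finType := ('X_{1..n < (mdeg B).+1} * 'I_(gsub_rank M))%type.
(* Degrees of [T] not below [B] are given the zero generator in degree 0. *)
pose dT (t : T) : 'X_{1..n} := if (t.1 <= B)%MM then (t.1 : 'X_{1..n}) else 0%MM.
pose LT (t : T) : 'rV_(gsub_rank M) :=
  if (t.1 <= B)%MM then row t.2 (gsub_mx M t.1) else 0.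
exists #|T|, (fun p => dT (enum_val p)), (\matrix_p LT (enum_val p)).
split=> [p|].
  by rewrite /dT; case: ifP => // _; apply/mnm_lepP => i; rewrite mnm0E.
split=> [p|c v].
  by rewrite rowK /LT /dT; case: ifP => _; rewrite ?row_sub ?sub0mx.
move/minB; set c0 := minm c B => /submxP[a ->].
have := lem_minm c0 c B; rewrite lepm_refl => /esym/andP[le_c0c le_c0B].
have lt_c0 : (mdeg c0 < (mdeg B).+1)%N.
  by rewrite ltnS !mdegE; apply: leq_sum => i _; apply/mnm_lepP.
pose b0 := BMultinom lt_c0.
exists (\row_p (if (enum_val p).1 == b0 then a 0 (enum_val p).2 else 0)).
  by move=> p; rewrite mxE /dT; case: ifP => [/eqP->|]; rewrite ?eqxx //= le_c0B.
rewrite !mulmx_sum_row.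
transitivity (\sum_t (if t.1 == b0 then a 0 t.2 else 0) *: LT t); last first.
  rewrite (reindex (@enum_val T T)) /=; last exact/onW_bij/enum_val_bij.
  by apply: eq_bigr => p _; rewrite rowK mxE.
rewrite -(pair_bigA _ (fun b i => (if b == b0 then a 0 i else 0) *: LT (b, i))) /=.
rewrite (bigD1 b0) //= [X in _ = _ + X]big1 ?addr0 => [|b ne_b]; last first.
  by rewrite big1 // => i _; rewrite (negPf ne_b) scale0r.
by rewrite eqxx; apply: eq_bigr => i _; rewrite /LT le_c0B.
Qed.

(** A relation of degree [d p] with a unit coefficient at [p] expresses generator [p] through the
    others. *)
Lemma generates_drop M r (d : 'I_r.+1 -> 'X_{1..n}) L (a : 'rV_r.+1) p :
  @generates M r.+1 d L -> supported d (d p) a -> a *m L = 0 -> a 0 p != 0 ->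
  @generates M r (fun q => d (fintype.lift p q)) (row' p L).
Proof.
move=> [rowL genL] sa aL ap; split=> [q|c v /genL[b sb ->]].
  by rewrite (_ : row q _ = row (fintype.lift p q) L) //; apply/rowP => j; rewrite !mxE.
pose b' := b - (b 0 p / a 0 p) *: a.
have b'p : b' 0 p = 0 by rewrite !mxE divfK ?subrr.
(* If [b] involves [p], then [d p] lies below [c], and so does the support of [a]; otherwise nothing
   is subtracted. *)
have sb' : supported d c b'.
  move=> q; rewrite !mxE; have [->|/sb//] := eqVneq (b 0 q) 0.
  have [->|/sa le_qp] := eqVneq (a 0 q) 0; first by rewrite mulr0 subr0 eqxx.
  have [->|/sb le_pc _] := eqVneq (b 0 p) 0; last exact: lepm_trans le_qp le_pc.
  by rewrite mul0r mul0r subr0 eqxx.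
exists (\row_q b' 0 (fintype.lift p q)); first by move=> q; rewrite mxE; apply: sb'.
transitivity (b' *m L); first by rewrite mulmxBl -scalemxAl aL scaler0 subr0.
apply/rowP => j; rewrite !mxE (bigD1_ord p) //= b'p mul0r add0r.
by apply: eq_bigr => q _; rewrite !mxE.
Qed.

Definition supp_mx r (d : 'I_r -> 'X_{1..n}) c : 'M[k]_r :=
  diag_mx (\row_p (d p <= c)%MM%:R).

Lemma supp_mxP r (d : 'I_r -> 'X_{1..n}) c (a : 'rV[k]_r) :
  reflect (supported d c a) (a <= supp_mx d c)%MS.
Proof.
apply: (iffP submxP) => [[D ->] p|sa].
  by rewrite mul_mx_diag !mxE; case: (d p <= c)%MM => //; rewrite mulr0 eqxx.
exists a; apply/rowP => p; rewrite mul_mx_diag !mxE.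
by have [->|/sa->] := eqVneq (a 0 p) 0; rewrite ?mul0r ?mulr1.
Qed.

Definition syzygies M r (d : 'I_r -> 'X_{1..n}) (L : 'M[k]_(r, gsub_rank M)) : gsub :=
  GSub d (fun c => kermx L :&: supp_mx d c)%MS.

Lemma syzygiesP M r d (L : 'M[k]_(r, gsub_rank M)) c (a : 'rV_r) :
  (a <= gsub_mx (@syzygies M r d L) c)%MS <-> supported d c a /\ a *m L = 0.
Proof.
rewrite sub_capmx (sameP sub_kermxP eqP).
by split=> [/andP[/eqP ? /supp_mxP]|[/supp_mxP -> ->]]; rewrite ?eqxx.
Qed.

(** A generating set of least size admits no relation with a unit coefficient, by [generates_drop];
    this puts the syzygies in the maximal ideal. Generators of degree below [B] keep the bound for
    the syzygies. *)
Lemma minimal_generators B M : bounded_gsub B M ->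
  exists r d L, bounded_gsub B (@syzygies M r d L) /\ generates d L.
Proof.
move=> bM; pose has_gens r := `[< exists (d : 'I_r -> 'X_{1..n}) L,
  (forall p, (d p <= B)%MM) /\ @generates M r d L >].
have ex_gens : exists r, has_gens r.
  by have [r gens_r] := generates_exists bM; exists r; apply/asboolP.
have [r /asboolP[d [L [dB gensL]]] min_r] := ex_minnP ex_gens.
exists r, d, L; split=> //; split=> //=.
- move=> c a p /syzygiesP[sa aL] ap; rewrite sa //=; apply/eqP => def_c.
  case: r p d L dB gensL min_r a sa aL ap def_c => [[]//|r] p d L dB gensL min_r.
  move=> a sa aL ap def_c; suff /min_r : has_gens r by rewrite ltnn.
  apply/asboolP; exists (fun q => d (fintype.lift p q)), (row' p L); split=> //.
  by apply: generates_drop ap => //; rewrite def_c.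
- move=> c c' a le_cc' /syzygiesP[sa aL]; apply/syzygiesP; split=> // p /sa le_pc.
  exact: lepm_trans le_cc'.
- move=> c a /syzygiesP[sa aL]; apply/syzygiesP; split=> // p /sa le_pc.
  by rewrite lem_minm le_pc dB.
Qed.

Lemma generates_graded B M r d L : bounded_gsub B M -> @generates M r d L ->
  graded d (@gsub_deg M) L /\
  forall p q, L p q != 0 -> gsub_deg q != d p.
Proof.
move=> bM [rowL _]; split=> p q Lpq; have := gsub_supp bM (p := q) (rowL p);
  by rewrite mxE => /(_ Lpq)/andP[].
Qed.

(** Passes from vector spaces back to polynomials: each graded component of [u] is lifted over k,
    homogenised, and the lifts are summed. *)
Lemma generates_image B M r d L (u : 'rV[R]_(gsub_rank M)) :
  bounded_gsub B M -> @generates M r d L ->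
  (forall c, comp_row (@gsub_deg M) c u <= gsub_mx M c)%MS <->
  exists v, u = v *m graded_mx d (@gsub_deg M) L.
Proof.
move=> bM gensL; have [gL _] := generates_graded bM gensL.
split=> [in_u|[v ->] c].
  have /choice[a aP] c : exists a, supported d c a /\
      comp_row (@gsub_deg M) c u = a *m L.
    by have [a] := generates_sub gensL (in_u c); exists a.
  have [S ->] := sum_homog_comp (@gsub_deg M) u.
  exists (\sum_(c <- S) homog_row d c (a c)); rewrite mulmx_suml.
  by apply: eq_bigr => c _; have [sa ->] := aP c; rewrite homog_row_mulmx.
rewrite comp_row_mulmx // mulmx_sum_row; apply: summx_sub => p _.
have [->|] := eqVneq (comp_row d c v 0 p) 0; first by rewrite scale0r sub0mx.
move/comp_row_supported => le_pc; apply: scalemx_sub.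
exact (gsub_mono bM le_pc (generates_row gensL p)).
Qed.

Lemma syzygies_kernel M r d L (u : 'rV[R]_r) : graded d (@gsub_deg M) L ->
  u *m graded_mx d (@gsub_deg M) L = 0 <->
  (forall c, comp_row d c u <= gsub_mx (@syzygies M r d L) c)%MS.
Proof.
move=> gL; split=> [uL c|in_u].
  apply/syzygiesP; split; first exact: comp_row_supported.
  rewrite -(comp_row_mulmx _ _ gL) uL; apply/rowP => q; rewrite !mxE mcoeff0.
  exact: if_same.
have [S ->] := sum_homog_comp (@gsub_deg M) (u *m graded_mx d (@gsub_deg M) L).
apply: big1 => c _; rewrite comp_row_mulmx //.
have [_ ->] := (syzygiesP _ _ _ _).1 (in_u c).
by apply/rowP => q; rewrite !mxE scale0r.
Qed.

End Existence.

(** * Resolving a monomial ideal *)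

Section MonomialResolution.
Variables (k : fieldType) (n : nat) (ms : seq 'X_{1..n}).
Local Notation R := {mpoly k[n]}.

Definition monomial_gsub : gsub k n :=
  @GSub k n 1 (fun=> 0%MM) (fun c => if in_monomial_ideal ms c then 1%:M else 0).

(** The bound is the exponent of the product of all generators, which each of them divides.
    Properness puts the ideal inside the maximal ideal. *)
Lemma monomial_gsub_bounded : ~~ in_monomial_ideal ms 0%MM ->
  bounded_gsub (\sum_(m <- ms) m)%MM monomial_gsub.
Proof.
move=> notin0; have sub0 (v : 'rV[k]_1) c :
    (v <= gsub_mx monomial_gsub c)%MS -> v = 0 \/ in_monomial_ideal ms c.
  by rewrite /=; case: ifP => _; [right | rewrite submx0 => /eqP; left].
split=> /= [p|c v p|c c' v le_cc'|c v].
- by apply/mnm_lepP => i; rewrite mnm0E.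
- case/sub0=> [->|in_c _]; first by rewrite mxE eqxx.
  apply/andP; split; first by apply/mnm_lepP => i; rewrite mnm0E.
  by apply: contraNneq notin0 => ->.
- case/sub0=> [->|/hasP[m ms_m le_mc]]; first exact: sub0mx.
  by rewrite ifT ?submx1 //; apply/hasP; exists m => //; apply: lepm_trans le_cc'.
- case/sub0=> [->|/hasP[m ms_m le_mc]]; first exact: sub0mx.
  rewrite ifT ?submx1 //; apply/hasP; exists m => //; rewrite lem_minm le_mc /=.
  apply/mnm_lepP => i; rewrite mnm_sumE (big_rem m ms_m) /=; exact: leq_addr.
Qed.

(** Starts from the ideal inside R, placed in degree 0, and repeatedly takes minimal generators and
    their syzygies. *)
Lemma monomial_resolution_exists : ~~ in_monomial_ideal ms 0%MM ->
  exists F : minimal_free_resolution [seq 'X_[k, m] | m <- ms], True.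
Proof.
move/monomial_gsub_bounded; set B := (\sum_(m <- ms) m)%MM => bM0.
pose T := {M : gsub k n | bounded_gsub B M}.
have next_ex (M : T) : {M' : T &
    {L : 'M[k]_(gsub_rank (sval M'), gsub_rank (sval M)) |
    generates (@gsub_deg _ _ (sval M')) L /\
    gsub_mx (sval M') = gsub_mx (syzygies (@gsub_deg _ _ (sval M')) L)}}.
  case: M => M bM; case: (cid (minimal_generators bM)) => r /cid[d /cid[L [bS gensL]]].
  by exists (exist _ (syzygies d L) bS); exists L.
pose fix seqM i : T :=
  if i is i'.+1 then projT1 (next_ex (seqM i')) else exist _ _ bM0.
pose L i := sval (projT2 (next_ex (seqM i))).
have gensL i : generates (@gsub_deg _ _ (sval (seqM i.+1))) (L i).
  exact: (svalP (projT2 (next_ex (seqM i)))).1.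
have seq_mxE i : gsub_mx (sval (seqM i.+1)) =
    gsub_mx (syzygies (@gsub_deg _ _ (sval (seqM i.+1))) (L i)).
  exact: (svalP (projT2 (next_ex (seqM i)))).2.
have bM i : bounded_gsub B (sval (seqM i)) := svalP (seqM i).
have gL i := (generates_graded (bM i) (gensL i)).1.
have min_L i := (generates_graded (bM i) (gensL i)).2.
have aug_coord (u : 'rV[R]_1) : (u *m (const_mx 1 : 'cV[R]_1)) 0 0 = u 0 0.
  by rewrite mxE big_ord1 mxE mulr1.
unshelve eexists (@MinimalFreeResolution k n _
  (fun i => gsub_rank (sval (seqM i))) (fun i => @gsub_deg _ _ (sval (seqM i)))
  (fun i => graded_mx (@gsub_deg _ _ (sval (seqM i.+1)))
     (@gsub_deg _ _ (sval (seqM i))) (L i))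
  (const_mx 1 : 'cV[R]_1) _ _ _ _ _ _) => //.
- by move=> p m; rewrite mxE msupp1 inE => /eqP ->.
- move=> i p q m; rewrite mxE; have [->|/gL le_qp] := eqVneq (L i p q) 0.
    by rewrite scale0r msupp0.
  by move/msuppZ_le; rewrite msuppX inE => /eqP ->; apply: submK.
- move=> f; exists (const_mx f : 'rV[R]_1).
  by rewrite aug_coord mxE subrr rpred0.
- move=> u; rewrite aug_coord -(generates_image u (bM 0%N) (gensL 0%N)).
  split=> [/ideal_gen_monomialP in_u c|in_u].
    rewrite /=; case: ifPn => [_|notin_c]; first exact: submx1.
    rewrite submx0; apply/eqP/rowP => p.
    rewrite !mxE ord1 subm0 memN_msupp_eq0 ?if_same //.
    by apply: contra notin_c => /in_u.
  apply/ideal_gen_monomialP => m; apply: contraTT => notin_m.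
  have := in_u m; rewrite /= (negPf notin_m) submx0 => /eqP/rowP/(_ 0)/eqP.
  rewrite !mxE subm0 ifT ?mcoeff_eq0 //.
  by apply/mnm_lepP => i; rewrite mnm0E.
- move=> i u; rewrite -(generates_image u (bM i.+1) (gensL i.+1)).
  by rewrite seq_mxE; apply: syzygies_kernel.
- move=> i p q; rewrite mxE mcoeffZ mcoeffX.
  have [->|Lpq] := eqVneq (L i p q) 0; first by rewrite mul0r.
  case: eqP => [eq0|_]; last by rewrite mulr0.
  (* A nonzero constant entry would need equal source and target degrees. *)
  case/eqP: (min_L i p q Lpq); rewrite -[RHS](submK (gL i p q Lpq)).
  by rewrite eq0 add0m.
Qed.

End MonomialResolution.

(** * Edge ideals *)

Section EdgeIdealResolutions.
Variables (k : fieldType) (n : nat) (D : wograph n).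
Local Notation w := (weight D).
Local Notation s := [seq 'X_[k, m] | m <- edge_monomials D].
Local Notation heavy_in_edges := (forall i, exists j, oedge D j i /\ (1 < w j)%N).

Lemma edge_resolution_exists : exists F : minimal_free_resolution s, True.
Proof.
apply: monomial_resolution_exists; apply/in_edge_idealP => -[x [y [_]]].
by rewrite mnm0E.
Qed.

(** Membership is tested on monomials: one of [f] outside the ideal would be a socle monomial,
    contrary to [socle_condition]. *)
Lemma edge_ideal_no_socle f : ~ heavy_in_edges ->
  (forall i : 'I_n, mvar k n i * f \in ideal_gen s) -> f \in ideal_gen s.
Proof.
move=> not_heavy socle_f; apply/ideal_gen_monomialP => m supp_m.
apply: contra_notT not_heavy => notin_m; apply: (socle_condition notin_m) => i.
have /ideal_gen_monomialP := socle_f i; apply.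
by rewrite mcoeff_msupp mcoeff_mulX_ord -mcoeff_msupp.
Qed.

Lemma edge_top_rank (F : minimal_free_resolution s) :
  ~ heavy_in_edges -> (0 < n)%N /\ mfr_rank F n = 0%N.
Proof.
move=> not_heavy; have n_gt0 : (0 < n)%N.
  (* For n = 0 the condition on the vertices holds vacuously. *)
  rewrite lt0n; apply: contra_notN not_heavy => /eqP n0 i.
  by have := ltn_ord i; rewrite {2}n0.
by split=> //; apply: mfr_top_rank_eq0 => // f; apply: edge_ideal_no_socle.
Qed.

Lemma edge_pdim_eq : pdim_eq (quot_ideal s) n <-> heavy_in_edges.
Proof.
have [F _] := edge_resolution_exists.
split=> [[_ min_n]|heavy].
  apply: contrapT => /(edge_top_rank F)[n_gt0 rank_n].
  suff /min_n : pdim_le (quot_ideal s) n.-1 by rewrite leqNgt ltn_predL n_gt0.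
  apply: (@mfr_pdim_le _ _ _ F) => i; rewrite -ltnS prednK // ltnS leq_eqVlt.
  by case/orP=> [/eqP <-|/mfr_rank_gt].
split=> [|e]; first by apply: (@mfr_pdim_le _ _ _ F) => i; apply: mfr_rank_gt.
apply: (@pdim_ge_socle _ _ _ 'X_[socle_monomial D]) => [|i].
  apply: contra (socle_monomial_notin D) => /ideal_gen_monomialP; apply.
  by rewrite msuppX inE.
apply/ideal_gen_monomialP => m; rewrite mvar_ord -mpolyXD addmC msuppX inE.
by move=> /eqP ->; apply: socle_monomial_mul.
Qed.

Lemma edge_mfr_betti (F : minimal_free_resolution s) :
  mfr_betti F n [multinom w i | i < n] <> 0%N <-> heavy_in_edges.
Proof.
rewrite /mfr_betti; split=> [/eqP|heavy].
  rewrite -lt0n card_gt0 => /set0Pn[p _]; apply: contrapT => /(edge_top_rank F)[_].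
  by move=> rank_n; have := ltn_ord p; rewrite {2}rank_n.
suff [p deg_p] : exists p : 'I_(mfr_rank F n), mfr_deg p = [multinom w i | i < n].
  by apply/eqP; rewrite -lt0n card_gt0; apply/set0Pn; exists p; rewrite inE deg_p.
(* For n > 0 the socle exponent w - (1, ..., 1) shifted by (1, ..., 1) is w. For n = 0 the ideal
   does not contain 1, so F_0 has a generator, and there is only one degree. *)
have [n0|n_gt0] := posnP n; last first.
  have [p def_p] := mfr_top_degree F n_gt0 (socle_monomial_notin D)
    (socle_monomial_mul heavy).
  exists p; rewrite def_p; apply/mnmP => i.
  rewrite mnmDE mnm_sumE !mnmE (bigD1 i) //= mnm1E eqxx.
  rewrite big1 => [|j /negPf ne_ji]; last by rewrite mnm1E ne_ji.
  by rewrite addn0 addn1 prednK // weight_gt0.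
have [u] := mfr_aug_surj F 1; have [rank0|] := posnP (mfr_rank F 0).
  rewrite mxE big1 ?sub0r => [/ideal_gen_monomialP/(_ 0%MM)|p _]; last first.
    by have := ltn_ord p; rewrite {2}rank0.
  rewrite mcoeff_msupp mcoeffN mcoeff1 eqxx oppr_eq0 oner_eq0 => /(_ isT).
  by case/in_edge_idealP => x; have := ltn_ord x; rewrite {2}n0.
have castE j : j = 0%N -> (0 < mfr_rank F 0)%N -> (0 < mfr_rank F j)%N by move->.
move/(castE n n0) => rank_gt0 _; exists (Ordinal rank_gt0).
by apply/mnmP => i; have := ltn_ord i; rewrite {2}n0.
Qed.

End EdgeIdealResolutions.

Theorem theorem4p2 (k : fieldType) (n : nat) (D : wograph n) :
  (pdim_eq (quot_ideal (edge_ideal_gens k D)) n <->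
     forall i : 'I_n, exists j : 'I_n, oedge D j i /\ (1 < weight D j)%N)
  /\
  (pdim_eq (quot_ideal (edge_ideal_gens k D)) n <->
     betti (edge_ideal_gens k D) n [multinom weight D i | i < n] <> 0%N).
Proof.
rewrite edge_ideal_gensE edge_pdim_eq /betti.
(* [betti] counts in a chosen resolution; [edge_mfr_betti] holds for any. *)
case: pselect => [F_ex|[]]; last exact: edge_resolution_exists.
by rewrite (edge_mfr_betti (projT1 (cid F_ex))).
Qed.
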